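(* Consider $\dot x=f(x,u(t))$ on $\mathbb R^{2N}$, semi-contracting on $\mathcal D\subseteq\mathbb R^{2N}$ with respect to $\|\cdot\|_R$ with rate $c>0$, with composite injection $u(t)=\bar u(t)+\tilde u(t)$, where $\|\dot{\bar u}(t)\|_2\le\epsilon$ and $\|\tilde u(t)\|_2\le\delta$. Let $x^*$, $H$ and $L_u$ be the quasi-steady map, its sensitivity bound and the input Lipschitz constant described in the context. Considering $x^*(\bar u(t))$ as the moving reference, for all $t\ge0$ $$\inf_{v\in\ker(R)}\|x(t)-(x^*(\bar u(t))+v)\|_R\le e^{-ct}\rho(0)+\frac{H\epsilon+L_u\delta}{c}\big(1-e^{-ct}\big),$$ where $\rho(0)\ge\inf_{v\in\ker(R)}\|x(0)-(x^*(\bar u(0))+v)\|_R$, with the corresponding ultimate bound $$\limsup_{t\to\infty}\ \inf_{v\in\ker(R)}\|x(t)-(x^*(\bar u(t))+v)\|_R\le\frac{H\epsilon+L_u\delta}{c}.$$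
   Context: $N\ge2$. $R_\theta\in\mathbb R^{(N-1)\times N}$ has orthonormal rows spanning $\mathrm{span}\{\mathbf 1_N\}^\perp$; $R:=\mathrm{blkdiag}(R_\theta,I_N)\in\mathbb R^{(2N-1)\times2N}$; $\|x\|_R:=\|Rx\|_2$ is a seminorm on $\mathbb R^{2N}$ with kernel $\ker(R)=\mathrm{span}\{[\mathbf 1_N^\top,\mathbf 0_N^\top]^\top\}$. Inputs. $\mathcal U\subseteq\mathbb R^{2N}$ is an admissible input set containing the values of $u(t)$ and $\bar u(t)$. There is a continuously differentiable quasi-steady map $x^*:\mathcal U\to\mathcal D$ with $\|f(x^*(w),w)\|_R=0$ and $\big\|\frac{\partial x^*}{\partial u}(w)\big\|_R\le H$ for all $w\in\mathcal U$, where $\|M\|_R:=\sup_{\|w\|_2=1}\|Mw\|_R$ for this matrix. $L_u$ is the Lipschitz constant of the vector field in the input at the nominal manifold, the nominal input being $\bar u=\bar u(t)$: $\|f(x^*(\bar u),w)-f(x^*(\bar u),\bar u)\|_R\le L_u\|w-\bar u\|_2$ for all $w\in\mathcal U$. Semi-contraction. $f(x,u)$ is continuously differentiable in $x\in\mathbb R^{2N}$ with Jacobian $D_xf(x,u)$. For $A\in\mathbb R^{2N\times2N}$ regarded as an operator on state space, $\|A\|_R:=\max\{\|Az\|_R: z\perp\ker(R),\ \|z\|_R=1\}$ and $\mu_R(A):=\lim_{h\to0^+}\frac{\|I+hA\|_R-1}{h}$, which equals $\lambda_{\max}\big(\tfrac12(RAR^\top+RA^\top R^\top)\big)$. The domain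 $\mathcal D$ is convex, and semi-contracting on $\mathcal D$ with rate $c>0$ with respect to $\|\cdot\|_R$ means $\mu_R(D_xf(x,u(t)))\le -c$ for all $x\in\mathcal D$, $t\ge0$. Standing property of the systems considered: $D_xf(x,u(t))\ker(R)\subseteq\ker(R)$ for all $x\in\mathcal D$, $t\ge0$. The slow component $\bar u(t)$ is differentiable in time (almost everywhere, and absolutely continuous), and $x(t)$ denotes a solution of $\dot x=f(x,u(t))$.
   Formalization: The solution is additionally assumed to remain in the semi-contraction domain, x(t) ∈ D for all t ≥ 0; without this the bound fails (e.g. D={0}, f_i=-x_i+x_i^3, x*=0, and x an equilibrium outside D). *)

(* Defs.v *)
From HB Require Import structures.
From mathcomp Require Import all_boot all_order all_algebra.
From mathcomp Require Import all_classical all_reals all_analysis.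
Set Implicit Arguments.
Unset Strict Implicit.
Unset Printing Implicit Defensive.
Import Order.TTheory GRing.Theory Num.Theory.
Import numFieldNormedType.Exports.
Local Open Scope classical_set_scope.
Local Open Scope ring_scope.

(* The norm `|x| of the library on column vectors is the sup norm. *)
Definition norm2 (R : realType) n (x : 'cV[R]_n) : R :=
  Num.sqrt (\sum_(i < n) x i 0 ^+ 2).

Definition Rmat (R : realType) N (Rth : 'M[R]_(N.-1, N)) :
    'M[R]_(N.-1 + N, N + N) :=
  block_mx Rth 0 0 1%:M.

Section seminorm.
Context (R : realType) (m n : nat) (Q : 'M[R]_(m, n)).

Definition snorm (x : 'cV[R]_n) : R := norm2 (Q *m x).

Definition kerR : set 'cV[R]_n := [set v | Q *m v = 0].

(* Norm of a matrix acting on the state space.  Its argument ranges over a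
   compact set, so this supremum is a maximum when Q <> 0. *)
Definition opnormR (A : 'M[R]_n) : R :=
  sup [set snorm (A *m z) | z in
    [set z | (forall v, kerR v -> v^T *m z = 0) /\ snorm z = 1]].

Definition lognormR (A : 'M[R]_n) : R :=
  lim ((opnormR (1%:M + h *: A) - 1) / h @[h --> 0^'+]).

(* Norm of a matrix from the (Euclidean) input space to the state space. *)
Definition inputnormR p (M : 'M[R]_(n, p)) : R :=
  sup [set snorm (M *m w) | w in [set w : 'cV[R]_p | norm2 w = 1]].

Definition distR (x y : 'cV[R]_n) : R :=
  inf [set snorm (x - (y + v)) | v in kerR].

End seminorm.

(* The library's jacobian is for row vectors, with v *m 'J f x = 'd f x v; here
   jacmx f x *m v = 'd f x v. *)
Definition jacmx (R : realType) n m (f : 'cV[R]_n -> 'cV[R]_m) (x : 'cV[R]_n) :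
    'M[R]_(m, n) :=
  \matrix_(i, j) ('d f x (delta_mx j 0 : 'cV[R]_n)) i 0.

Definition C1 (R : realType) n m (f : 'cV[R]_n -> 'cV[R]_m) : Prop :=
  (forall x, differentiable f x) /\ continuous (jacmx f).

(* J is a continuous derivative of g relative to U.  No topological assumption
   is made on U; at interior points of U, J is the usual Jacobian of g. *)
Definition C1_on (R : realType) n m (U : set 'cV[R]_n)
    (g : 'cV[R]_n -> 'cV[R]_m) (J : 'cV[R]_n -> 'M[R]_(m, n)) : Prop :=
  (forall w, U w -> forall e : R, 0 < e ->
     \forall w' \near within U (nbhs w),
       `|g w' - g w - J w *m (w' - w)| <= e * `|w' - w|) /\
  {within U, continuous J}.

Definition abs_continuous (R : realType) (V : normedModType R) (a b : R)
    (g : R -> V) : Prop :=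
  forall e : R, 0 < e -> exists2 d : R, 0 < d &
    forall k (l r : 'I_k -> R),
      (forall i, a <= l i /\ l i <= r i /\ r i <= b) ->
      trivIset [set: 'I_k] (fun i => `]l i, r i[%classic) ->
      \sum_(i < k) (r i - l i) < d ->
      \sum_(i < k) `|g (r i) - g (l i)| < e.

(* Solution on [0, +oo[ in the sense of Caratheodory: no continuity in time is
   required of the input. *)
Definition is_solution (R : realType) n p
    (f : 'cV[R]_n -> 'cV[R]_p -> 'cV[R]_n) (u : R -> 'cV[R]_p)
    (x : R -> 'cV[R]_n) : Prop :=
  (forall T : R, 0 < T -> abs_continuous 0 T x) /\
  {ae lebesgue_measure, forall t : R, 0 < t ->
     is_derive t (1 : R) x (f (x t) (u t))}.

Definition semi_contracting (R : realType) m n p (Q : 'M[R]_(m, n))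
    (D : set 'cV[R]_n) (f : 'cV[R]_n -> 'cV[R]_p -> 'cV[R]_n)
    (u : R -> 'cV[R]_p) (c : R) : Prop :=
  forall x (t : R), D x -> 0 <= t -> lognormR Q (jacmx (f^~ (u t)) x) <= - c.

Definition kernel_invariant (R : realType) m n p (Q : 'M[R]_(m, n))
    (D : set 'cV[R]_n) (f : 'cV[R]_n -> 'cV[R]_p -> 'cV[R]_n)
    (u : R -> 'cV[R]_p) : Prop :=
  forall x (t : R) v, D x -> 0 <= t -> kerR Q v ->
    kerR Q (jacmx (f^~ (u t)) x *m v).

(* Main.v *)
Require Import Defs.
From HB Require Import structures.
From mathcomp Require Import all_boot all_order all_algebra.
From mathcomp Require Import all_classical all_reals all_analysis.
From mathcomp Require Import measurable_realfun ring lra.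
Set Implicit Arguments.
Unset Strict Implicit.
Unset Printing Implicit Defensive.
Import Order.TTheory GRing.Theory Num.Theory.
Import numFieldNormedType.Exports.
Local Open Scope classical_set_scope.
Local Open Scope ring_scope.

(** Write [Q] for the matrix of the seminorm, [y = xs (ubar t)] and
    [e = Q (x - y)], so that the distance to bound is [|e|].  Since [Q Q^T = 1]
    and the Jacobians preserve [ker Q], the bound on the logarithmic norm says
    [<Qz, Q J z> <= - c |Qz|^2], and the mean value theorem along the segment from
    [y] to [x] gives [<e, Q (f x u - f y u)> <= - c |e|^2].  As [Q f(y, ubar) = 0],
    the remaining part of [e'] has norm at most [H eps + Lu delta], whence
    [<e, e'> <= - c |e|^2 + (H eps + Lu delta) |e|] almost everywhere.
    The set [U] is arbitrary, so [xs] need not be Lipschitz along [ubar]; but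
    near every time [|e s - e t|] is at most a fixed multiple of
    [|x s - x t| + |ubar s - ubar t|].  This everywhere local domination by
    absolutely continuous functions suffices for Gronwall's inequality with an
    almost everywhere derivative. *)

(** * Euclidean norm *)

Section euclidean.
Context {R : realType}.

Definition dot n (u v : 'cV[R]_n) : R := \sum_(i < n) u i 0 * v i 0.

Lemma dotC n (u v : 'cV[R]_n) : dot u v = dot v u.
Proof. by apply: eq_bigr => i _; rewrite mulrC. Qed.

Lemma dotDr n (u v w : 'cV[R]_n) : dot u (v + w) = dot u v + dot u w.
Proof. by rewrite -big_split; apply: eq_bigr => i _ /=; rewrite mxE mulrDr. Qed.

Lemma dotZr n (u v : 'cV[R]_n) a : dot u (a *: v) = a * dot u v.
Proof. by rewrite mulr_sumr; apply: eq_bigr => i _; rewrite mxE; ring. Qed.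

Lemma dotNr n (u v : 'cV[R]_n) : dot u (- v) = - dot u v.
Proof. by rewrite -scaleN1r dotZr mulN1r. Qed.

Lemma dotDl n (u v w : 'cV[R]_n) : dot (v + w) u = dot v u + dot w u.
Proof. by rewrite dotC dotDr !(dotC u). Qed.

Lemma dotZl n (u v : 'cV[R]_n) a : dot (a *: v) u = a * dot v u.
Proof. by rewrite dotC dotZr (dotC u). Qed.

Lemma dotNl n (u v : 'cV[R]_n) : dot (- v) u = - dot v u.
Proof. by rewrite dotC dotNr (dotC u). Qed.

Lemma dotE n (u v : 'cV[R]_n) : dot u v = (u^T *m v) 0 0.
Proof. by rewrite mxE; apply: eq_bigr => i _; rewrite mxE. Qed.

Lemma dotvv_ge0 n (u : 'cV[R]_n) : 0 <= dot u u.
Proof. by apply: sumr_ge0 => i _; rewrite -expr2 sqr_ge0. Qed.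

Lemma norm2_ge0 n (u : 'cV[R]_n) : 0 <= norm2 u.
Proof. exact: sqrtr_ge0. Qed.

Lemma sqr_norm2 n (u : 'cV[R]_n) : norm2 u ^+ 2 = dot u u.
Proof.
rewrite sqr_sqrtr; first by apply: eq_bigr => i _; rewrite expr2.
by apply: sumr_ge0 => i _; rewrite sqr_ge0.
Qed.

Lemma norm2E n (u : 'cV[R]_n) : norm2 u = Num.sqrt (dot u u).
Proof. by rewrite -sqr_norm2 sqrtr_sqr ger0_norm ?norm2_ge0. Qed.

Lemma norm2Z n (u : 'cV[R]_n) a : norm2 (a *: u) = `|a| * norm2 u.
Proof. by rewrite !norm2E dotZl dotZr mulrA -expr2 sqrtrM ?sqr_ge0// sqrtr_sqr. Qed.

Lemma norm2N n (u : 'cV[R]_n) : norm2 (- u) = norm2 u.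
Proof. by rewrite -scaleN1r norm2Z normrN1 mul1r. Qed.

Lemma norm20 n : norm2 (0 : 'cV[R]_n) = 0.
Proof. by rewrite -(scale0r 0) norm2Z normr0 mul0r. Qed.

Lemma norm2_eq0 n (u : 'cV[R]_n) : norm2 u = 0 -> u = 0.
Proof.
move=> u0; have : dot u u = 0 by rewrite -sqr_norm2 u0 expr0n.
move/eqP; rewrite psumr_eq0 => [/allP h|i _]; last by rewrite -expr2 sqr_ge0.
apply/matrixP => i j; rewrite ord1 mxE; apply/eqP.
by have := h i (mem_index_enum _); rewrite -expr2 sqrf_eq0.
Qed.

(** Cauchy-Schwarz: the squared length of [norm2 v *: u - norm2 u *: v] is nonnegative and has
    [norm2 u * norm2 v - dot u v] as a factor, the other factor being positive. *)
Lemma dot_le n (u v : 'cV[R]_n) : dot u v <= norm2 u * norm2 v.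
Proof.
have [u0|u0] := eqVneq (norm2 u) 0.
  by rewrite u0 mul0r (norm2_eq0 u0) -(scale0r 0) dotZl mul0r.
have [v0|v0] := eqVneq (norm2 v) 0.
  by rewrite v0 mulr0 (norm2_eq0 v0) -(scale0r 0) dotZr mul0r.
have ugt : 0 < norm2 u by rewrite lt_neqAle eq_sym u0 norm2_ge0.
have vgt : 0 < norm2 v by rewrite lt_neqAle eq_sym v0 norm2_ge0.
have := dotvv_ge0 (norm2 v *: u - norm2 u *: v).
have -> : dot (norm2 v *: u - norm2 u *: v) (norm2 v *: u - norm2 u *: v) =
    2 * (norm2 u * norm2 v) * (norm2 u * norm2 v - dot u v).
  rewrite dotDl !dotDr !dotNl !dotNr !dotZl !dotZr -!sqr_norm2 (dotC v u); ring.
by rewrite pmulr_rge0 ?subr_ge0// !mulr_gt0.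
Qed.

Lemma norm2D n (u v : 'cV[R]_n) : norm2 (u + v) <= norm2 u + norm2 v.
Proof.
rewrite -(@ler_pXn2r _ 2)// ?nnegrE ?addr_ge0 ?norm2_ge0//.
rewrite sqr_norm2 dotDl !dotDr -!sqr_norm2 (dotC v u).
by have := dot_le u v; nra.
Qed.

Lemma coord_le_norm2 n (u : 'cV[R]_n) i : `|u i 0| <= norm2 u.
Proof.
rewrite -sqrtr_sqr ler_sqrt; last by apply: sumr_ge0 => j _; rewrite sqr_ge0.
by rewrite (bigD1 i)//= lerDl sumr_ge0// => j _; rewrite sqr_ge0.
Qed.

Lemma coord_le_norm n (u : 'cV[R]_n) i : `|u i 0| <= `|u|.
Proof.
by rewrite -[`|u|]/(mx_norm u) mx_normrE; apply/bigmax_geP; right => /=; exists (i, 0).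
Qed.

Lemma norm_le_norm2 n (u : 'cV[R]_n) : `|u| <= norm2 u.
Proof.
rewrite -[`|u|]/(mx_norm u) mx_normrE; apply/bigmax_leP; split; first exact: norm2_ge0.
by case=> i j _ /=; rewrite ord1 coord_le_norm2.
Qed.

(** Summing squares would give the factor sqrt n; the cruder [n] avoids a root and suffices wherever
    only some fixed constant matters. *)
Lemma norm2_le_norm n (u : 'cV[R]_n) : norm2 u <= n%:R * `|u|.
Proof.
rewrite -(@ler_pXn2r _ 2)// ?nnegrE ?mulr_ge0 ?norm2_ge0//.
rewrite sqr_norm2 (@le_trans _ _ (\sum_(i < n) `|u| ^+ 2))//.
  apply: ler_sum => i _; rewrite -expr2 -real_normK ?num_real//.
  by rewrite ler_pXn2r ?nnegrE// coord_le_norm.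
rewrite sumr_const card_ord -[leLHS]mulr_natl exprMn ler_wpM2r ?sqr_ge0//.
by rewrite -natrX ler_nat; case: n {u} => // n; rewrite expnS expn1 leq_pmulr.
Qed.

Lemma norm2_delta n (i : 'I_n) : norm2 (delta_mx i 0 : 'cV[R]_n) = 1.
Proof.
rewrite norm2E /dot (bigD1 i)//= big1 => [|j /negPf ji].
  by rewrite mxE !eqxx mulr1 addr0 sqrtr1.
by rewrite mxE ji/= mul0r.
Qed.

Lemma mulmx_bounded m n (A : 'M[R]_(m, n)) :
  exists2 C, 0 <= C & forall v, norm2 (A *m v) <= C * norm2 v.
Proof.
pose C := \sum_(i < m) norm2 (row i A)^T.
have C0 : 0 <= C by apply: sumr_ge0 => i _; exact: norm2_ge0.
exists (m%:R * C) => [|v]; first by rewrite mulr_ge0.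
apply: le_trans (norm2_le_norm _) _; rewrite -mulrA ler_wpM2l//.
rewrite -[leLHS]/(mx_norm (A *m v)) mx_normrE; apply/bigmax_leP; split.
  exact: (mulr_ge0 C0 (norm2_ge0 v)).
case=> i j _ /=; rewrite ord1.
have rowE w : (A *m w) i 0 = dot (row i A)^T w.
  by rewrite dotE trmxK -row_mul [RHS]mxE.
have bound w : (A *m w) i 0 <= C * norm2 w.
  rewrite rowE (le_trans (dot_le _ _))// ler_wpM2r ?norm2_ge0//.
  by rewrite /C (bigD1 i)//= lerDl sumr_ge0// => k _; exact: norm2_ge0.
(* The one-sided bound taken at [- v] supplies the other half of the absolute value. *)
rewrite ler_norml bound andbT lerNl.
by have := bound (- v); rewrite mulmxN mxE norm2N.
Qed.

End euclidean.

(** * The seminorm and its logarithmic norm *)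

Section seminorm_facts.
Context {R : realType} {m n : nat} (Q : 'M[R]_(m, n)).
Hypothesis QQt : Q *m Q^T = 1%:M.

Lemma snorm_ge0 z : 0 <= snorm Q z.
Proof. exact: norm2_ge0. Qed.

Lemma snormD y z : snorm Q (y + z) <= snorm Q y + snorm Q z.
Proof. by rewrite /snorm mulmxDr norm2D. Qed.

Lemma snormZ a z : snorm Q (a *: z) = `|a| * snorm Q z.
Proof. by rewrite /snorm -scalemxAr norm2Z. Qed.

(** Translation by the kernel leaves [Q *m (x - y)] unchanged, so the infimum runs over a single
    value. *)
Lemma distRE x y : distR Q x y = snorm Q (x - y).
Proof.
rewrite /distR (_ : [set _ | _ in _] = [set snorm Q (x - y)]) ?inf1//.
apply/seteqP; split => [_ [v Qv <-]|_ ->]/=.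
  by rewrite /snorm opprD addrA mulmxDr mulmxN Qv subr0.
by exists 0; rewrite ?addr0//= /kerR /= mulmx0.
Qed.

Lemma inputnormR_ge p (M : 'M[R]_(n, p)) w :
  snorm Q (M *m w) <= inputnormR Q M * norm2 w.
Proof.
have [w0|w0] := eqVneq (norm2 w) 0.
  by rewrite w0 mulr0 (norm2_eq0 w0) /snorm !mulmx0 norm20.
have wgt : 0 < norm2 w by rewrite lt_neqAle eq_sym w0 norm2_ge0.
rewrite -ler_pdivrMr// mulrC -[X in X * _]gtr0_norm ?invr_gt0// -snormZ scalemxAr.
apply: ub_le_sup; last first.
  by exists ((norm2 w)^-1 *: w) => //=; rewrite norm2Z gtr0_norm ?invr_gt0// mulVf.
(* The supremum dominates its members once the set is known to be bounded. *)
have [C C0 hC] := mulmx_bounded (Q *m M).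
by exists C => _ [v /= v1 <-]; rewrite /snorm mulmxA (le_trans (hC _))// v1 mulr1.
Qed.

Lemma inputnormR_ge0 p (M : 'M[R]_(n, p)) : (0 < p)%N -> 0 <= inputnormR Q M.
Proof.
move=> p0; have := inputnormR_ge M (delta_mx (Ordinal p0) 0).
by rewrite norm2_delta mulr1; exact/le_trans/snorm_ge0.
Qed.

Lemma norm2_mulTmx (e : 'cV[R]_m) : norm2 (Q^T *m e) = norm2 e.
Proof.
by rewrite !norm2E !dotE trmx_mul trmxK mulmxA -(mulmxA _ Q) QQt mulmx1.
Qed.

(** Since [Q Q^T = 1], the vector [k = z - Q^T Q z] lies in the kernel. It is therefore orthogonal
    to [z] by hypothesis and to the range of [Q^T], hence to itself. *)
Lemma orth_kerRE (z : 'cV[R]_n) :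
  (forall v, kerR Q v -> v^T *m z = 0) -> z = Q^T *m (Q *m z).
Proof.
move=> zorth; set k := z - Q^T *m (Q *m z).
have kk : kerR Q k by rewrite /kerR/= /k mulmxBr (mulmxA Q) QQt mul1mx subrr.
suff : k = 0 by move/eqP; rewrite subr_eq0 => /eqP.
apply: norm2_eq0; rewrite norm2E dotE {2}/k mulmxBr zorth// (mulmxA k^T) -trmx_mul.
by rewrite kk trmx0 mul0mx subr0 mxE sqrtr0.
Qed.

Let sphere := [set z : 'cV[R]_n | (forall v, kerR Q v -> v^T *m z = 0) /\ snorm Q z = 1].

Let sphere_lift (e : 'cV[R]_m) : norm2 e = 1 -> sphere (Q^T *m e).
Proof.
move=> e1; split; last by rewrite /snorm mulmxA QQt mul1mx.
by move=> v Qv; rewrite mulmxA -trmx_mul Qv trmx0 mul0mx.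
Qed.

Lemma opnormR_has_ubound (A : 'M[R]_n) : has_ubound [set snorm Q (A *m z) | z in sphere].
Proof.
have [C C0 hC] := mulmx_bounded (Q *m A).
exists C => _ [z /= [zorth z1] <-]; rewrite /snorm mulmxA (le_trans (hC _))//.
by rewrite (orth_kerRE zorth) norm2_mulTmx -/(snorm Q z) z1 mulr1.
Qed.

Lemma opnormR_ge (A : 'M[R]_n) (z : 'cV[R]_n) : (forall v, kerR Q v -> v^T *m z = 0) ->
  snorm Q z = 1 -> snorm Q (A *m z) <= opnormR Q A.
Proof. by move=> *; apply: (ub_le_sup (opnormR_has_ubound A)); exists z. Qed.

(* The difference quotients of h |-> |I + hA|_R are nondecreasing by convexity
   and bounded below, so the limit defining the logarithmic norm exists. *)
Lemma lognormR_cvg (A : 'M[R]_n) : (0 < m)%N ->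
  (opnormR Q (1%:M + h *: A) - 1) / h @[h --> 0^'+] --> lognormR Q A.
Proof.
move=> m0; pose o (h : R) := opnormR Q (1%:M + h *: A).
have [z zorth z1] : exists2 z : 'cV[R]_n,
    (forall v, kerR Q v -> v^T *m z = 0) & snorm Q z = 1.
  have [zorth z1] := sphere_lift (norm2_delta (Ordinal m0)).
  by exists (Q^T *m delta_mx (Ordinal m0) 0).
suff /cvg_ex[l cvgl] : cvg ((o h - 1) / h @[h --> 0^'+]).
  by rewrite /lognormR (cvg_lim _ cvgl).
apply: nondecreasing_at_right_is_cvgr.
- near=> b => h k; rewrite !in_itv/= => /andP[h0 _] /andP[k0 _] hk.
  (* Convexity: [1 + hA] is the combination of [1] and [1 + kA] with weights [1 - h/k] and [h/k]. *)
  have ohk : o h <= (1 - h / k) + h / k * o k.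
    apply: sup_le_ub; first by exists (snorm Q ((1%:M + h *: A) *m z)); exists z.
    move=> _ [y [yorth y1] <-].
    have -> : (1%:M + h *: A) *m y =
        (1 - h / k) *: y + (h / k) *: ((1%:M + k *: A) *m y).
      rewrite !mulmxDl mul1mx -!scalemxAl scalerDr scalerA divfK ?gt_eqF//.
      by rewrite addrA -scalerDl subrK scale1r.
    have hk0 : 0 <= h / k by rewrite divr_ge0 ?ltW.
    apply: le_trans (snormD _ _) _; rewrite !snormZ y1 mulr1 ger0_norm; last first.
      by rewrite subr_ge0 ler_pdivrMr// mul1r.
    by rewrite lerD2l ger0_norm// ler_wpM2l// opnormR_ge.
  rewrite ler_pdivrMr// mulrAC (le_trans (lerB ohk (lexx 1)))//.
  by rewrite le_eqVlt; apply/orP; left; apply/eqP; field; rewrite gt_eqF.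
(* Lower bound from the triangle inequality 1 = |z| <= |(1 + hA)z| + h|Az|. *)
- near=> b; exists (- snorm Q (A *m z)) => _ [h/= + <-].
  rewrite in_itv/= => /andP[h0 _]; rewrite ler_pdivlMr// lerBrDr.
  apply: le_trans (opnormR_ge (1%:M + h *: A) zorth z1).
  rewrite mulmxDl mul1mx -scalemxAl mulNr addrC lerBlDr -{1}z1.
  rewrite -[X in snorm Q X <= _](addrK (h *: (A *m z))).
  by rewrite (le_trans (snormD _ _))// -scaleNr snormZ normrN gtr0_norm// mulrC.
Unshelve. all: by end_near. Qed.

(** Kernel invariance allows replacing [z] by [Q^T Q z]. For a unit vector w, Cauchy-Schwarz bounds
    1 + h<w, QAQ^T w> by the operator norm of [1 + hA], which is at most 1 + (mu + eta)h for small h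
    > 0; then eta is arbitrary. *)
Lemma lognormR_form_le (A : 'M[R]_n) (mu : R) z : (0 < m)%N ->
  (forall v, kerR Q v -> kerR Q (A *m v)) -> lognormR Q A <= mu ->
  dot (Q *m z) (Q *m (A *m z)) <= mu * snorm Q z ^+ 2.
Proof.
move=> m0 Aker Amu; set e := Q *m z.
have -> : Q *m (A *m z) = Q *m (A *m (Q^T *m e)).
  have : kerR Q (z - Q^T *m e) by rewrite /kerR/= mulmxBr (mulmxA Q) QQt mul1mx subrr.
  by move/Aker; rewrite /kerR/= !mulmxBr => /eqP; rewrite subr_eq0 => /eqP.
rewrite /snorm -/e; have [e0|e0] := eqVneq (norm2 e) 0.
  by rewrite e0 expr0n/= mulr0 (norm2_eq0 e0) -(scale0r 0) dotZl mul0r.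
have egt : 0 < norm2 e by rewrite lt_neqAle eq_sym e0 norm2_ge0.
pose w := (norm2 e)^-1 *: e.
have w1 : norm2 w = 1 by rewrite norm2Z gtr0_norm ?invr_gt0// mulVf.
have [worth w1'] := sphere_lift w1.
suff : dot w (Q *m (A *m (Q^T *m w))) <= mu.
  rewrite /w -!scalemxAr dotZl dotZr mulrA -invfM -expr2 mulrC.
  by rewrite ler_pdivrMr ?exprn_gt0.
clearbody w; apply/ler_addgt0Pr => eta eta0.
have : \forall h \near 0^'+, (opnormR Q (1%:M + h *: A) - 1) / h < mu + eta.
  by have := lognormR_cvg (A:=A) m0; move/cvgr_lt; apply; rewrite (le_lt_trans Amu)// ltrDl.
move=> near_lt; near (0 : R)^'+ => h.
have h0 : 0 < h by [].
have : (opnormR Q (1%:M + h *: A) - 1) / h < mu + eta by near: h.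
rewrite ltr_pdivrMr// => /ltW; rewrite lerBlDr => oh.
have : dot w (Q *m ((1%:M + h *: A) *m (Q^T *m w))) <= 1 + (mu + eta) * h.
  rewrite (le_trans (dot_le _ _))// w1 mul1r [leRHS]addrC (le_trans _ oh)//.
  exact: opnormR_ge.
rewrite mulmxDl mul1mx -scalemxAl mulmxDr mulmxA QQt mul1mx -scalemxAr dotDr dotZr.
by rewrite -sqr_norm2 w1 expr1n lerD2l mulrC ler_pM2r.
Unshelve. all: by end_near. Qed.

End seminorm_facts.

Lemma Rmat_orthonormal (R : realType) N (Rth : 'M[R]_(N.-1, N)) :
  Rth *m Rth^T = 1%:M -> Rmat Rth *m (Rmat Rth)^T = 1%:M.
Proof.
move=> h; rewrite /Rmat tr_block_mx mulmx_block !trmx0 !trmx1 !mulmx0 !mul0mx.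
by rewrite mulmx1 !addr0 add0r h -scalar_mx_block.
Qed.

(** * Monotonicity from almost everywhere derivatives *)

(** Clearing the denominator includes the case [s = t] and lets error terms be added and mapped
    linearly without handling quotients. *)
Lemma is_derive_nearP {R : realType} (V : normedModType R) (f : R -> V) (t : R) (l : V) :
  is_derive t 1 f l <->
  forall e : R, 0 < e -> \forall s \near t, `|f s - f t - (s - t) *: l| <= e * `|s - t|.
Proof.
split=> [[df dfl] e e0|H].
  have /cvgrPdist_le /(_ e e0) [r /= r0 hr] :
      h^-1 *: ((f \o shift t) (h *: 1) - f t) @[h --> 0^'] --> l.
    by rewrite -dfl; exact: df.
  exists r => //= s; rewrite /ball/= => str.
  have [->|st] := eqVneq s t; first by rewrite !subrr scale0r subrr !normr0 mulr0.
  have st0 : s - t != 0 by rewrite subr_eq0.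
  have := hr (s - t); rewrite /= sub0r normrN distrC => /(_ str st0).
  rewrite scaler1 subrK distrC => hle.
  rewrite -{1}(scale1r (f s - f t)) -(mulfV st0) -scalerA -scalerBr normrZ mulrC.
  by rewrite ler_wpM2r// distrC.
have cvgl : h^-1 *: ((f \o shift t) (h *: 1) - f t) @[h --> 0^'] --> l.
  apply/cvgrPdist_le => e e0; have [r /= r0 hr] := H e e0.
  exists r => //= h; rewrite /ball/= sub0r normrN => hlt h0.
  have := hr (h + t); rewrite /= opprD addrCA subrr addr0 normrN => /(_ hlt).
  rewrite scaler1 addrK => hle.
  rewrite -{1}(scale1r l) -(mulVf h0) -scalerA -scalerBr normrZ normfV distrC.
  by rewrite ler_pdivrMl ?normr_gt0// mulrC.
by split; [apply/cvg_ex; exists l | exact: cvg_lim cvgl].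
Qed.

Section absolute_continuity.
Context {R : realType}.
Implicit Types (a b : R) (w : R -> R -> R).

(* [abs_continuous a b g] is [small_sums a b (fun l r => `|g r - g l|)]. *)
Definition small_sums a b w := forall e : R, 0 < e -> exists2 d : R, 0 < d &
  forall k (l r : 'I_k -> R),
    (forall i, a <= l i /\ l i <= r i /\ r i <= b) ->
    trivIset [set: 'I_k] (fun i => `]l i, r i[%classic) ->
    \sum_(i < k) (r i - l i) < d ->
    \sum_(i < k) w (l i) (r i) < e.

Lemma small_sums_length a b : small_sums a b (fun l r => r - l).
Proof. by move=> e e0; exists e. Qed.

Lemma small_sumsD a b w w' : small_sums a b w -> small_sums a b w' ->
  small_sums a b (fun l r => w l r + w' l r).
Proof.
move=> hw hw' e e0; have e20 : 0 < e / 2 by rewrite divr_gt0.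
have [d d0 hd] := hw _ e20; have [d' d'0 hd'] := hw' _ e20.
exists (Num.min d d') => [|k l r lr tr]; first by rewrite lt_min d0.
rewrite lt_min => /andP[? ?]; rewrite big_split/= [ltRHS]splitr.
by rewrite ltrD ?hd ?hd'.
Qed.

(** Lists, ordered from right to left, allow a chain of intervals to be extended by prepending a
    link; the ordering makes the open intervals disjoint. *)
Lemma small_sums_seq a b w : small_sums a b w ->
  forall e : R, 0 < e -> exists2 d : R, 0 < d & forall s : seq (R * R),
    all (fun p : R * R => (a <= p.1 <= p.2) && (p.2 <= b)) s ->
    pairwise (fun p q : R * R => q.2 <= p.1) s ->
    \sum_(p <- s) (p.2 - p.1) < d -> \sum_(p <- s) w p.1 p.2 < e.
Proof.
move=> hw e /hw[d d0 hd]; exists d => // s /allP sab spw.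
rewrite !(big_tnth _ _ s) => sd.
apply: (hd _ (fun i => (tnth (in_tuple s) i).1) (fun i => (tnth (in_tuple s) i).2)) => //.
  by move=> i; have /sab := mem_tnth i (in_tuple s); case/andP => /andP[].
have disj (i j : 'I_(size s)) x : (i < j)%N ->
    (tnth (in_tuple s) i).1 < x < (tnth (in_tuple s) i).2 ->
    (tnth (in_tuple s) j).1 < x < (tnth (in_tuple s) j).2 -> False.
  move=> ij /andP[ix _] /andP[_ xj].
  have := pairwiseP (0, 0) spw i j (ltn_ord i) (ltn_ord j) ij.
  rewrite -!(tnth_nth _ (in_tuple s)) leNgt => /negP; apply.
  exact: lt_trans xj.
move=> i j _ _ [x /= []]; rewrite !in_itv/= => xi xj.
by have [ij|ij|/val_inj//] := ltngtP i j; [case: (disj i j x)|case: (disj j i x)].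
Qed.

(** Continuous induction at the supremum of the points satisfying [P]: one step reaches the supremum
    from a point close on its left, another would pass beyond it if it were less than [b]. Each step
    has [t] as an endpoint, which is the kind of increment a derivative at [t] controls. *)
Lemma segment_induction a b (P : R -> Prop) : a <= b -> P a ->
  (forall t, a <= t <= b -> \forall d \near (0 : R)^'+, forall s s',
     a <= s -> s <= s' -> s' <= b -> t - d < s -> s' < t + d -> s = t \/ s' = t ->
     P s -> P s') ->
  P b.
Proof.
move=> ab Pa step; pose S := [set t | a <= t <= b /\ P t].
have Sa : S a by split=> //; rewrite lexx.
have Sub : has_ubound S by exists b => t [/andP[]].
have supS : has_sup S by split; [exists a|].
have a_t0 : a <= sup S by exact: ub_le_sup.
have t0b : sup S <= b by apply: sup_le_ub => [|t [/andP[]]//]; exists a.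
have [d [d0 dstep]] : exists d : R, 0 < d /\ forall s s',
     a <= s -> s <= s' -> s' <= b -> sup S - d < s -> s' < sup S + d ->
     s = sup S \/ s' = sup S -> P s -> P s'.
  have := step (sup S); rewrite a_t0 t0b => /(_ isT) near_step.
  by near (0 : R)^'+ => d; exists d; split=> //; near: d.
have Pt0 : P (sup S).
  have [s [/andP[as_ sb] Ps] ds] := sup_adherent d0 supS.
  have st0 : s <= sup S by apply: ub_le_sup => //; split=> //; rewrite as_.
  by apply: (dstep s) => //; [rewrite ltrDl|right].
have [t0E|t0Nb] := eqVneq (sup S) b; first by rewrite -t0E.
have t0ltb : sup S < b by rewrite lt_neqAle t0Nb.
pose s' := Num.min b (sup S + d / 2).
have t0s' : sup S < s' by rewrite lt_min t0ltb ltrDl divr_gt0.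
have Ps' : P s'.
  apply: (dstep (sup S)) => //; [exact: ltW|by rewrite ge_min lexx| | |by left].
    by rewrite ltrBlDr ltrDl.
  by rewrite gt_min ltrD2l ltr_pdivrMr// ltr_pMr// ltr1n orbT.
have : s' <= sup S.
  apply: ub_le_sup => //; split=> //; rewrite (le_trans a_t0 (ltW t0s'))/=.
  by rewrite ge_min lexx.
by rewrite leNgt t0s'.
Unshelve. all: by end_near. Qed.

Local Notation mu := (@lebesgue_measure R).

(** Outer regularity, applied to a measurable null set containing [E]. *)
Lemma negligible_open_cover (E : set R) (d : R) : 0 < d -> mu.-negligible E ->
  exists2 G : set R, open G & E `<=` G /\ (mu G < d%:E)%E.
Proof.
move=> d0 [B [mB B0 EB]].
have B0' : (mu B < +oo)%E by rewrite [mu B]B0 ltry.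
have [G [oO BO OB]] := lebesgue_regularity_outer mB B0' d0.
have mO : measurable G by exact: open_measurable.
exists G => //; split; first exact: subset_trans EB BO.
have -> : mu G = (mu B + mu (G `\` B))%E.
  rewrite -[in LHS](setDUK BO); apply: measureU; rewrite ?setDIK//.
  exact: measurableD.
by rewrite [mu B]B0 add0e.
Qed.

(* Given e, the null set E is covered by an open set G of small measure.  A
   chain from a to b is built whose links either have slope at most e or lie
   inside G; absolute continuity makes the total increment of the latter small. *)
Lemma le_of_ae_derive_le0 a b w (C : R) (E : set R) (h : R -> R) :
  a <= b -> 0 <= C -> small_sums a b w -> mu.-negligible E ->
  (forall t, a <= t <= b -> \forall s \near t, a <= s <= b ->
     `|h s - h t| <= C * w (Num.min s t) (Num.max s t)) ->
  (forall t, a < t < b -> ~ E t -> exists2 l, is_derive t (1 : R) h l & l <= 0) ->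
  h b <= h a.
Proof.
move=> ab C0 hw E0 hdom hder; apply/ler_addgt0Pr => e e0.
(* Half of [e] pays for the links of small slope, the other half for those inside [G]; adding 1
   keeps the divisors positive. *)
pose e1 := e / 2 / (b - a + 1).
have ba1 : 0 < b - a + 1 by rewrite ltr_wpDl// subr_ge0.
have e10 : 0 < e1 by rewrite !divr_gt0.
have C1 : 0 < C + 1 by rewrite ltr_wpDl.
have e2C : 0 < e / 2 / (C + 1) by rewrite !divr_gt0.
have [d d0 hd] := small_sums_seq hw e2C.
(* The endpoints join the exceptional set because derivatives are given in the open interval
   only. *)
have Eab0 : mu.-negligible (E `|` [set a; b]).
  have neg1 c : mu.-negligible [set c]
    by exists [set c]; split=> //; exact: lebesgue_measure_set1.
  by apply: negligibleU => //; apply: negligibleU.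
have [G oO [EO Od]] := negligible_open_cover d0 Eab0.
have mO : measurable G by exact: open_measurable.
(* The list records only the links inside [G]. Half-open intervals make the measure additive when a
   new link is attached at [t]. *)
pose P t := a <= t /\ exists s : seq (R * R),
  [/\ all (fun p : R * R => (a <= p.1 <= p.2) && (p.2 <= t)) s,
      pairwise (fun p q : R * R => q.2 <= p.1) s,
      ((\sum_(p <- s) (p.2 - p.1))%:E <= mu (G `&` `[a, t[))%E &
      h t - h a <= e1 * (t - a) + C * \sum_(p <- s) w p.1 p.2].
have Pa : P a.
  by split=> //; exists [::]; rewrite !big_nil !subrr !mulr0 addr0.
have monoP (s : seq (R * R)) t t' : t <= t' ->
    all (fun p : R * R => (a <= p.1 <= p.2) && (p.2 <= t)) s ->
    all (fun p : R * R => (a <= p.1 <= p.2) && (p.2 <= t')) s.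
  by move=> tt'; apply: sub_all => p /andP[-> pt]; exact: le_trans tt'.
have good t t' : P t -> t <= t' -> h t' - h t <= e1 * (t' - t) -> P t'.
  move=> [at_ [s [sab spw smu sh]]] tt' htt'; split; first exact: le_trans tt'.
  exists s; split=> //; first exact: monoP sab.
    apply: le_trans smu _; apply: le_measure; rewrite ?inE.
    - by apply: measurableI.
    - by apply: measurableI.
    - apply: setIS => x /=; rewrite !in_itv/= => /andP[-> xt].
      exact: lt_le_trans tt'.
  by move: sh htt'; lra.
have bad t t' : P t -> t <= t' -> `[t, t'[ `<=` G ->
    h t' - h t <= C * w t t' -> P t'.
  move=> [at_ [s [sab spw smu sh]]] tt' ttO htt'; split; first exact: le_trans tt'.
  exists ((t, t') :: s); split=> /=.
  - by rewrite at_ tt' lexx/=; exact: monoP sab.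
  - by rewrite spw andbT; apply: sub_all sab => p /andP[].
  - rewrite big_cons/= EFinD addeC.
    have -> : G `&` `[a, t'[ = (G `&` `[a, t[) `|` `[t, t'[.
      apply/seteqP; split=> x /=; rewrite !in_itv/=.
        by move=> [Gx /andP[ax xt']]; case: (ltP x t) => xt;
          [left; rewrite ax|right].
      case=> [[Gx /andP[ax xt]]|/andP[tx xt']].
        by split=> //; rewrite ax (lt_le_trans xt).
      by split; [apply: ttO; rewrite /= in_itv/= tx|rewrite (le_trans at_)].
    have -> : mu ((G `&` `[a, t[) `|` `[t, t'[) =
        (mu (G `&` `[a, t[) + mu `[t, t'[%classic)%E.
      apply: measureU => //; first exact: measurableI.
      apply/seteqP; split=> // x /=; rewrite !in_itv/= => -[[_ /andP[_ xt]] /andP[tx _]].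
      by move: xt; rewrite ltNge tx.
    rewrite leeD// lebesgue_measure_itv/= lte_fin.
    by case: ltP => //; rewrite lee_fin subr_le0.
  - by rewrite big_cons/= mulrDr; have := mulr_ge0 (ltW e10) (_ : 0 <= t' - t);
      rewrite subr_ge0 => /(_ tt'); move: sh htt'; lra.
have [_ [s [sab spw smu sh]]] : P b.
  apply: (segment_induction ab Pa) => t /andP[at_ tb].
  (* At an exceptional time, short links lie in [G] and domination bounds their increment; elsewhere
     the nonpositive derivative gives slope at most [e1]. *)
  have [Et|Et] := pselect ((E `|` [set a; b]) t).
    have [r /= r0 rO] : \forall x \near t, G x.
      exact: (open_nbhs_nbhs (conj oO (EO _ Et))).
    have [r' /= r'0 r'dom] := hdom t (introT andP (conj at_ tb)).
    near=> dl => s s' as_ ss' s'b ts s't sst Ps.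
    have dlr : dl < r by near: dl; exact: nbhs_right_lt.
    have dlr' : dl < r' by near: dl; exact: nbhs_right_lt.
    apply: (bad s) => //.
      move=> x /=; rewrite in_itv/= => /andP[sx xs']; apply: rO.
      by rewrite /ball/= ltr_norml; apply/andP; split; lra.
    case: sst => st.
      have := r'dom s'; rewrite /ball/= -st (le_trans as_ ss') s'b.
      rewrite (min_idPr ss') (max_idPl ss') => hs'.
      apply: (le_trans (ler_norm _)); apply: hs' => //.
      by rewrite ltr_norml; apply/andP; split; lra.
    have := r'dom s; rewrite /ball/= -st as_ (le_trans ss' s'b).
    rewrite (min_idPl ss') (max_idPr ss') distrC => hs.
    apply: (le_trans (ler_norm _)); rewrite distrC; apply: hs => //.
    by rewrite ltr_norml; apply/andP; split; lra.
  have tab : a < t < b.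
    rewrite !lt_neqAle at_ tb !andbT; apply/andP; split; apply/eqP => tE; apply: Et.
      by right; left.
    by right; right.
  have [l dl l0] := hder t tab (fun Ett => Et (or_introl Ett)).
  have [r /= r0 hr] := (is_derive_nearP h t l).1 dl e1 e10.
  near=> dlt => s s' as_ ss' s'b ts s't sst Ps.
  have dlr : dlt < r by near: dlt; exact: nbhs_right_lt.
  apply: (good s) => //.
  case: sst => st.
    have := hr s'; rewrite /ball/= -st => /(_ _)/wrap[].
      by rewrite ltr_norml; apply/andP; split; lra.
    rewrite (ger0_norm (_ : 0 <= s' - s)) ?subr_ge0// => /ler_normlP[_].
    have : (s' - s) * l <= 0 by rewrite mulr_ge0_le0// subr_ge0.
    by rewrite /GRing.scale/=; lra.
  have := hr s; rewrite /ball/= -st => /(_ _)/wrap[].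
    by rewrite ltr_norml; apply/andP; split; lra.
  rewrite distrC (distrC s) (ger0_norm (_ : 0 <= s' - s)) ?subr_ge0// => /ler_normlP[_].
  have : (s' - s) * l <= 0 by rewrite mulr_ge0_le0// subr_ge0.
  by rewrite /GRing.scale/=; lra.
(* The recorded links have total length at most the measure of [G], which is below [d]. *)
have sw : \sum_(p <- s) w p.1 p.2 < e / 2 / (C + 1).
  apply: hd => //; rewrite -lte_fin; apply: le_lt_trans smu _.
  apply: le_lt_trans Od; apply: le_measure; rewrite ?inE//.
  by apply: measurableI.
have Csw : C * \sum_(p <- s) w p.1 p.2 <= e / 2.
  apply: le_trans (ler_wpM2l C0 (ltW sw)) _.
  by rewrite mulrA ler_pdivrMr// mulrC ler_wpM2l ?divr_ge0 ?ltW// ltrDl.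
have e1ba : e1 * (b - a) <= e / 2.
  rewrite /e1 mulrAC ler_pdivrMr// ler_wpM2l ?divr_ge0 ?ltW// ltrDl//.
by move: sh Csw e1ba; lra.
Unshelve. all: by end_near. Qed.

End absolute_continuity.

(** * Derivatives along curves *)

Section derivatives.
Context {R : realType}.

Lemma is_derive_coord n (f : R -> 'cV[R]_n) (t : R) l (i : 'I_n) :
  is_derive t 1 f l -> is_derive t 1 (fun s => f s i 0) (l i 0).
Proof.
move=> /is_derive_nearP fl; apply/is_derive_nearP => e e0.
apply: filterS (fl e e0) => s; apply: le_trans.
by rewrite (le_trans _ (coord_le_norm _ i))// !mxE.
Qed.

Lemma is_derive_mulmx m n (A : 'M[R]_(m, n)) (f : R -> 'cV[R]_n) (t : R) l :
  is_derive t 1 f l -> is_derive t 1 (fun s => A *m f s) (A *m l).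
Proof.
move=> /is_derive_nearP fl; apply/is_derive_nearP => e e0.
have [C C0 hC] := mulmx_bounded A.
(* The factor [n] comes from passing between the sup norm and the Euclidean norm. *)
have C1 : 0 < C * n%:R + 1 by rewrite ltr_wpDl// mulr_ge0.
apply: filterS (fl _ (divr_gt0 e0 C1)) => s hs.
rewrite -mulmxBr scalemxAr -mulmxBr (le_trans (norm_le_norm2 _))//.
rewrite (le_trans (hC _))// (le_trans (ler_wpM2l C0 (norm2_le_norm _)))// mulrA.
rewrite (le_trans (ler_wpM2l _ hs)) ?mulr_ge0// mulrA ler_wpM2r//.
by rewrite mulrA ler_pdivrMr// mulrC ler_wpM2l ?ltW// ltrDl.
Qed.

Lemma is_derive_dot n (f g : R -> 'cV[R]_n) (t : R) df dg :
  is_derive t 1 f df -> is_derive t 1 g dg ->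
  is_derive t 1 (fun s => dot (f s) (g s)) (dot (f t) dg + dot df (g t)).
Proof.
move=> fd gd.
rewrite (_ : (fun _ => _) =
    \sum_(i < n) ((fun s => f s i 0) * (fun s => g s i 0))); last first.
  by rewrite fct_sumE; apply/funext => s; apply: eq_bigr.
rewrite -big_split/=; apply: is_derive_sum => i.
rewrite (_ : _ + _ = f t i 0 *: dg i 0 + g t i 0 *: df i 0).
  by apply: is_deriveM; exact: is_derive_coord.
by congr (_ + _); rewrite mulrC.
Qed.

Lemma diff_jacmx n m (F : 'cV[R]_n -> 'cV[R]_m) p z : 'd F p z = jacmx F p *m z.
Proof.
have {1}-> : z = \sum_(j < n) z j 0 *: (delta_mx j 0 : 'cV[R]_n).
  by rewrite {1}[z]matrix_sum_delta; apply: eq_bigr => j _; rewrite big_ord1.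
rewrite linear_sum/=; apply/colP => i; rewrite summxE [RHS]mxE.
by apply: eq_bigr => j _; rewrite linearZ/= mxE [RHS]mulrC mxE.
Qed.

(** The difference quotients of the restriction to the line are those of [F] in the direction
    [z]. *)
Lemma is_derive_line n m (F : 'cV[R]_n -> 'cV[R]_m) y z (s : R) :
  differentiable F (y + s *: z) ->
  is_derive s 1 (fun r => F (y + r *: z)) (jacmx F (y + s *: z) *m z).
Proof.
move=> dF; have dz := diff_derivable (v:=z) dF.
have E : (fun h : R => h^-1 *: ((F \o shift (y + s *: z)) (h *: z) - F (y + s *: z))) =
    (fun h : R => h^-1 *: (((fun r => F (y + r *: z)) \o shift s) (h *: 1)
      - F (y + s *: z))).
  apply/funext => h /=; congr (_ *: (F _ - _)).
  by rewrite scalerDl [h *: 1]mulr1 addrCA.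
split; first by rewrite /derivable -E.
rewrite -diff_jacmx -(deriveE z dF) /derive.
by move: E => <-.
Qed.

(* Mean value theorem for r |-> <Qz, Q F(y + rz)> on [0, 1], z = x - y. *)
Lemma form_le_of_jacmx n m (Q : 'M[R]_(m, n)) (D : set 'cV[R]_n)
    (F : 'cV[R]_n -> 'cV[R]_n) (mu : R) x y :
  convex_set D -> (forall p, differentiable F p) ->
  (forall p z, D p -> dot (Q *m z) (Q *m (jacmx F p *m z)) <= mu * snorm Q z ^+ 2) ->
  D x -> D y ->
  dot (Q *m (x - y)) (Q *m (F x - F y)) <= mu * snorm Q (x - y) ^+ 2.
Proof.
move=> cD dF formF Dx Dy; set z := x - y.
pose psi (r : R) := dot (Q *m z) (Q *m F (y + r *: z)).
pose dpsi (r : R) := dot (Q *m z) (Q *m (jacmx F (y + r *: z) *m z)).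
have psiD (r : R) : is_derive r (1 : R) psi (dpsi r).
  have := is_derive_dot (is_derive_cst (Q *m z) r (1 : R))
    (is_derive_mulmx Q (is_derive_line (dF (y + r *: z)))).
  by rewrite -(scale0r 0) dotZl mul0r addr0.
have [|r + ] := @MVT_segment R psi dpsi 0 1 ler01 (fun r _ => psiD r).
  by apply: derivable_within_continuous => r _; exact: ex_derive.
rewrite in_itv/= subr0 mulr1 => /andP[r0 r1].
rewrite /psi scale0r addr0 scale1r (_ : y + z = x) ?(addrC y) ?subrK//.
rewrite (mulmxBr Q (F x)) dotDr dotNr => ->.
apply: formF; rewrite (_ : y + r *: z = r *: x + (1 - r) *: y).
  by have := cD x y (Itv01 r0 r1); rewrite !inE; apply.
by rewrite /z scalerBr scalerBl scale1r addrCA.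
Qed.

(** Chain rule: the curve stays in [U] near [t], so the expansion of [g] relative to [U] applies
    along it. Half of the error goes to this expansion, using [|v s - v t| <= (|dv| + 1) |s - t|],
    and half to the derivative of [J (v t) *m v]. *)
Lemma C1_on_derive n m (U : set 'cV[R]_n) (g : 'cV[R]_n -> 'cV[R]_m) J
    (v : R -> 'cV[R]_n) (t : R) dv :
  C1_on U g J -> (\forall s \near t, U (v s)) -> is_derive t 1 v dv ->
  is_derive t 1 (g \o v) (J (v t) *m dv).
Proof.
move=> [gJ _] Uv vd; have Uvt : U (v t) by exact: nbhs_singleton Uv.
have vct : {for t, continuous v}.
  exact/differentiable_continuous/derivable1_diffP/(@ex_derive _ _ _ _ _ _ _ vd).
have Jvd := is_derive_mulmx (J (v t)) vd.
move: vd Jvd => /is_derive_nearP vd /is_derive_nearP Jvd.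
apply/is_derive_nearP => e e0.
have dv1 : 0 < `|dv| + 1 by rewrite ltr_wpDl.
have e2 : 0 < e / 2 by rewrite divr_gt0.
have := gJ _ Uvt _ (divr_gt0 e2 dv1); rewrite near_withinE => /vct near_g.
near=> s => /=.
have gs : `|g (v s) - g (v t) - J (v t) *m (v s - v t)|
    <= e / 2 / (`|dv| + 1) * `|v s - v t|.
  by (have : U (v s) by near: s); near: s.
have Js : `|J (v t) *m v s - J (v t) *m v t - (s - t) *: (J (v t) *m dv)|
    <= e / 2 * `|s - t|.
  by near: s; exact: Jvd.
have vs : `|v s - v t - (s - t) *: dv| <= 1 * `|s - t| by near: s; exact: vd.
have {}vs : `|v s - v t| <= (`|dv| + 1) * `|s - t|.
  rewrite -[v s - v t](subrK ((s - t) *: dv)) (le_trans (ler_normD _ _))//.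
  by rewrite normrZ; move: vs; lra.
have -> : g (v s) - g (v t) - (s - t) *: (J (v t) *m dv) =
    (g (v s) - g (v t) - J (v t) *m (v s - v t)) +
    (J (v t) *m (v s - v t) - (s - t) *: (J (v t) *m dv)) by rewrite addrA subrK.
rewrite (le_trans (ler_normD _ _))// [e]splitr mulrDl lerD ?mulmxBr// -?mulmxBr.
apply: le_trans gs _; rewrite mulrAC ler_pdivrMr// -[leRHS]mulrA ler_pM2l//.
by rewrite [leRHS]mulrC.
Unshelve. all: by end_near. Qed.

End derivatives.

(** * Gronwall's inequality *)

Section gronwall.
Context {R : realType}.
Implicit Types (a b : R) (w : R -> R -> R) (E : set R).

(** The neighbourhood may shrink with [t] while [C] is uniform. Minimum and maximum put the
    endpoints in the order that [w] expects. *)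
Definition dominated_on a b w (C : R) (d : R -> R -> R) := forall t : R, a <= t <= b ->
  \forall s \near t, a <= s <= b -> d s t <= C * w (Num.min s t) (Num.max s t).

Lemma small_sums_near a b w : small_sums a b w -> forall e t : R, 0 < e -> a <= t <= b ->
  \forall s \near t, a <= s <= b -> w (Num.min s t) (Num.max s t) < e.
Proof.
move=> hw e t e0 /andP[at_ tb]; have [d d0 hd] := small_sums_seq hw e0.
exists d => //= s; rewrite /ball/= => std /andP[as_ sb].
have := hd [:: (Num.min s t, Num.max s t)]; rewrite !big_seq1/=; apply.
  by rewrite !andbT le_min as_ at_ ge_max sb tb ge_min le_max lexx.
  by [].
case: (leP s t) => st.
  by rewrite -[ltLHS]ger0_norm ?subr_ge0.
by rewrite -[ltLHS]ger0_norm ?subr_ge0 1?distrC// ltW.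
Qed.

Lemma dominated_continuous a b w (C : R) (g : R -> R) : 0 <= C -> small_sums a b w ->
  dominated_on a b w C (fun s t => `|g s - g t|) -> {within `[a, b], continuous g}.
Proof.
move=> C0 hw gdom; apply/subspace_continuousP => t; rewrite /= in_itv/= => tab.
apply/cvgrPdist_lt => e e0; rewrite near_withinE.
have C1 : 0 < C + 1 by rewrite ltr_wpDl.
have := small_sums_near hw (divr_gt0 e0 C1) tab.
move: (gdom t tab); apply: filterS2 => s hs ws; rewrite /= in_itv/= => sab.
rewrite distrC (le_lt_trans (hs sab))//.
rewrite (@le_lt_trans _ _ (C * (e / (C + 1))))//; first by rewrite ler_wpM2l// ltW// ws.
by rewrite mulrA ltr_pdivrMr// mulrC ltr_pM2l// ltrDl.
Qed.

(** For [t <= s], factor out [expR (c * s)] and use 1 - exp(-r) <= r. *)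
Lemma expR_lipschitz (c T s t : R) : 0 <= c -> s <= T -> t <= T ->
  `|expR (c * s) - expR (c * t)| <= c * expR (c * T) * `|s - t|.
Proof.
move=> c0; wlog st : s t / t <= s => [hw|] sT tT.
  by have [/hw|/ltW/hw] := leP t s; last rewrite distrC (distrC s); exact.
rewrite !ger0_norm ?subr_ge0 ?ler_expR ?ler_wpM2l//.
have -> : c * t = c * s + - (c * (s - t)) by ring.
rewrite expRD -[X in X - _]mulr1 -mulrBr.
rewrite (_ : c * _ * _ = expR (c * T) * (c * (s - t))); last by ring.
apply: ler_pM; rewrite ?expR_ge0// ?ler_expR ?ler_wpM2l//.
  by rewrite subr_ge0 -expR0 ler_expR oppr_le0 mulr_ge0// subr_ge0.
by have := expR_ge1Dx (- (c * (s - t))); lra.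
Qed.

(** The function exp(ct)(g t - K/c) has derivative exp(ct)(g' + c g - K) <= 0 almost everywhere, and
    its increments are locally dominated by [w] plus interval length; hence it does not increase
    from 0 to [T]. *)
Lemma gronwall_ae (T c K C : R) w E (g : R -> R) :
  0 <= T -> 0 < c -> 0 <= C -> (forall l r, 0 <= w l r) -> small_sums 0 T w ->
  lebesgue_measure.-negligible E ->
  dominated_on 0 T w C (fun s t => `|g s - g t|) ->
  (forall t : R, 0 < t < T -> ~ E t ->
     exists2 l, is_derive t (1 : R) g l & l <= - c * g t + K) ->
  g T <= expR (- c * T) * g 0 + K / c * (1 - expR (- c * T)).
Proof.
move=> T0 c0 C0 w0 hw E0 gdom gder; set k := K / c.
(* Domination makes [g] continuous, hence bounded; the bound controls the part of the increment due
   to the exponential. *)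
have [B hB] : exists B, forall s, 0 <= s <= T -> `|g s - k| <= B.
  have [|s0 _ hs0] := @EVT_max R (fun s => `|g s - k|) 0 T T0.
    apply: (dominated_continuous C0 hw) => t tT; apply: filterS (gdom t tT) => s hs sT.
    apply: le_trans (hs sT); rewrite (le_trans (ler_dist_dist _ _))//.
    by rewrite opprB addrA subrK.
  by exists (`|g s0 - k|) => s sT; apply: hs0; rewrite in_itv.
have B0 : 0 <= B by apply: le_trans (hB 0 _); rewrite ?lexx.
pose h t := expR (c * t) * (g t - k); pose M := expR (c * T).
have M0 : 0 <= M by exact: expR_ge0.
suff : h T <= h 0.
  rewrite /h mulr0 expR0 mul1r => hT.
  have -> : - c * T = - (c * T) by rewrite mulNr.
  rewrite expRN -/M; have Mgt : 0 < M by exact: expR_gt0.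
  rewrite -(ler_pM2l Mgt) mulrDr mulrA mulfV ?gt_eqF// mul1r.
  have -> : M * (k * (1 - M^-1)) = M * k - k.
    by rewrite mulrCA mulrBr mulfV ?gt_eqF// mulr1 mulrBr mulr1 mulrC.
  by move: hT; rewrite -/M; lra.
pose A := M * C; pose A' := c * M * B.
have A0 : 0 <= A by rewrite mulr_ge0.
have A'0 : 0 <= A' by rewrite !mulr_ge0// ltW.
apply: (le_of_ae_derive_le0 T0 (addr_ge0 A0 A'0)
          (small_sumsD hw (@small_sums_length R 0 T)) E0).
- move=> t tT; apply: filterS (gdom t tT) => s hs sT.
  have /andP[s0 sleT] := sT; have /andP[t0 tleT] := tT.
  have -> : h s - h t = (expR (c * s) - expR (c * t)) * (g s - k)
      + expR (c * t) * (g s - g t) by rewrite /h; ring.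
  have minmax : Num.max s t - Num.min s t = `|s - t|.
    by case: leP => st; [rewrite distrC|]; rewrite ger0_norm ?subr_ge0// ltW.
  rewrite minmax (le_trans (ler_normD _ _))// !normrM (ger0_norm (expR_ge0 _)).
  set W := w _ _; have W0 : 0 <= W by exact: w0.
  have h1 : `|expR (c * s) - expR (c * t)| * `|g s - k| <= A' * `|s - t|.
    rewrite /A' mulrAC; apply: ler_pM => //; last exact: hB.
    by apply: expR_lipschitz => //; exact: ltW.
  have h2 : expR (c * t) * `|g s - g t| <= A * W.
    rewrite /A -mulrA; apply: ler_pM; rewrite ?expR_ge0//; last exact: hs.
    by rewrite ler_expR ler_wpM2l// ltW.
  apply: le_trans (lerD h1 h2) _; rewrite mulrDl !mulrDr.
  have := mulr_ge0 A0 (normr_ge0 (s - t)); have := mulr_ge0 A'0 W0.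
  clear; lra.
- move=> t tT Et; have [l gl lle] := gder t tT Et.
  have cD : is_derive t (1 : R) (fun s : R => c * s) c.
    have := is_deriveZ c (is_derive_id t (1 : R)).
    by rewrite /GRing.scale/= mulr1.
  have eD : is_derive t (1 : R) (fun s => expR (c * s)) (expR (c * t) * c).
    exact: (is_derive1_comp (is_derive_expR (c * t)) cD).
  have gD : is_derive t (1 : R) (fun s => g s - k) l.
    by have := is_deriveB gl (is_derive_cst k t (1 : R)); rewrite subr0.
  exists (expR (c * t) * l + (g t - k) * (expR (c * t) * c)).
    exact: (is_deriveM eD gD).
  rewrite mulrCA -mulrDr mulr_ge0_le0 ?expR_ge0//.
  rewrite mulrBl /k divfK ?gt_eqF//.
  by move: lle; rewrite mulNr (mulrC c); lra.
Qed.

(** With A and B the two roots, (A - B)(A + B) = (|u| - |v|)(|u| + |v|), while |u| <= A and |v| <=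
    B. *)
Lemma smoothed_norm_lipschitz n (u v : 'cV[R]_n) (eta : R) : 0 < eta ->
  `|Num.sqrt (dot u u + eta ^+ 2) - Num.sqrt (dot v v + eta ^+ 2)| <= norm2 (u - v).
Proof.
move=> eta0; rewrite -!sqr_norm2.
have pos y : 0 < norm2 (y : 'cV[R]_n) ^+ 2 + eta ^+ 2.
  by rewrite ltr_wpDl ?sqr_ge0// exprn_gt0.
set A := Num.sqrt _; set B := Num.sqrt _.
have A2 : A ^+ 2 = norm2 u ^+ 2 + eta ^+ 2 by rewrite sqr_sqrtr// ltW.
have B2 : B ^+ 2 = norm2 v ^+ 2 + eta ^+ 2 by rewrite sqr_sqrtr// ltW.
have A0 : 0 < A by rewrite sqrtr_gt0.
have B0 : 0 < B by rewrite sqrtr_gt0.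
have le_sq (a b : R) : 0 <= a -> 0 < b -> b ^+ 2 = a ^+ 2 + eta ^+ 2 -> a <= b.
  move=> a0 b0 ab; rewrite -(@ler_pXn2r _ 2) ?nnegrE ?(ltW b0)// ab lerDl sqr_ge0//.
have uA := le_sq _ _ (norm2_ge0 u) A0 A2; have vB := le_sq _ _ (norm2_ge0 v) B0 B2.
have uv : `|norm2 u - norm2 v| <= norm2 (u - v).
  rewrite ler_norml; apply/andP; split.
    have := norm2D (v - u) u; rewrite subrK -(norm2N (v - u)) opprB; lra.
  by have := norm2D (u - v) v; rewrite subrK; lra.
apply: le_trans uv; rewrite -(ler_pM2r (addr_gt0 A0 B0)).
rewrite -{1}(gtr0_norm (addr_gt0 A0 B0)) -normrM.
have -> : (A - B) * (A + B) = (norm2 u - norm2 v) * (norm2 u + norm2 v).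
  by have -> : (A - B) * (A + B) = A ^+ 2 - B ^+ 2 by [ring]; rewrite A2 B2; ring.
by rewrite normrM ler_wpM2l// ger0_norm ?addr_ge0 ?norm2_ge0// lerD.
Qed.

(* The norm is not differentiable at 0, so Gronwall's inequality is applied to
   t |-> sqrt (|e t|^2 + eta^2) with K + c * eta in place of K, and eta tends to 0. *)
Lemma norm2_gronwall_ae m (T c K C : R) w E (e : R -> 'cV[R]_m) :
  0 <= T -> 0 < c -> 0 <= K -> 0 <= C -> (forall l r, 0 <= w l r) -> small_sums 0 T w ->
  lebesgue_measure.-negligible E ->
  dominated_on 0 T w C (fun s t => norm2 (e s - e t)) ->
  (forall t : R, 0 < t < T -> ~ E t -> exists2 de, is_derive t (1 : R) e de &
     dot (e t) de <= - c * norm2 (e t) ^+ 2 + K * norm2 (e t)) ->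
  norm2 (e T) <= expR (- c * T) * norm2 (e 0) + K / c * (1 - expR (- c * T)).
Proof.
move=> T0 c0 K0 C0 w0 hw E0 edom eder; apply/ler_addgt0Pr => eta eta0.
pose q t := dot (e t) (e t) + eta ^+ 2; pose g t := Num.sqrt (q t).
have q0 t : 0 < q t by rewrite /q ltr_wpDl ?dotvv_ge0// exprn_gt0.
have g0 t : 0 < g t by rewrite sqrtr_gt0.
have g2 t : g t ^+ 2 = norm2 (e t) ^+ 2 + eta ^+ 2.
  by rewrite sqr_sqrtr ?ltW// /q sqr_norm2.
have eta_g t : eta <= g t.
  by rewrite -(@ler_pXn2r _ 2) ?nnegrE ?(ltW eta0) ?(ltW (g0 t))// g2 lerDr sqr_ge0.
have norm_g t : norm2 (e t) <= g t.
  by rewrite -(@ler_pXn2r _ 2) ?nnegrE ?norm2_ge0 ?(ltW (g0 t))// g2 lerDl sqr_ge0.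
have g_norm t : g t <= norm2 (e t) + eta.
  rewrite -(@ler_pXn2r _ 2) ?nnegrE ?(ltW (g0 t)) ?addr_ge0 ?norm2_ge0 ?(ltW eta0)//.
  by rewrite g2 sqrrD lerD2r lerDl mulrn_wge0// mulr_ge0 ?norm2_ge0 ?ltW.
have : g T <= expR (- c * T) * g 0 + (K + c * eta) / c * (1 - expR (- c * T)).
  apply: (gronwall_ae T0 c0 C0 w0 hw E0).
    move=> t tT; apply: filterS (edom t tT) => s hs sT.
    exact: le_trans (smoothed_norm_lipschitz _ _ eta0) (hs sT).
  move=> t tT Et; have [de ed ede] := eder t tT Et.
  have qD : is_derive t (1 : R) q (2 * dot (e t) de).
    rewrite (_ : 2 * _ = dot (e t) de + dot de (e t) + 0).
      exact: (is_deriveD (is_derive_dot ed ed) (is_derive_cst (eta ^+ 2) t (1 : R))).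
    by rewrite addr0 (dotC de); ring.
  exists ((2 * g t)^-1 * (2 * dot (e t) de)).
    exact: (is_derive1_comp (is_derive1_sqrt (q0 t)) qD).
  have -> : (2 * g t)^-1 * (2 * dot (e t) de) = dot (e t) de / g t.
    by rewrite invfM mulrACA mulVf ?mul1r 1?mulrC// pnatr_eq0.
  (* Substituting |e|^2 = g^2 - eta^2 leaves the excess c eta^2, at most c eta g since eta <= g. *)
  rewrite ler_pdivrMr// (le_trans ede)// mulrDl -mulrA -expr2 g2 mulrDl.
  have h1 : K * norm2 (e t) <= K * g t by rewrite ler_wpM2l.
  have h2 : c * eta ^+ 2 <= c * eta * g t.
    by rewrite expr2 mulrA ler_wpM2l// mulr_ge0// ltW.
  by move: h1 h2; clear; lra.
(* With x the exponential, the smoothing errors x eta, from the initial value, and (1 - x) eta add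
   up to eta. *)
rewrite mulrDl [c * eta]mulrC mulfK ?gt_eqF//; set x := expR _; set k := K / c.
have x0 : 0 <= x by exact: expR_ge0.
have := ler_wpM2l x0 (g_norm 0); have := norm_g T; clear; lra.
Qed.

End gronwall.

(** A null set cannot contain the unit interval, which has measure 1. A single good time then yields
    the sign of [eps]. *)
Lemma ae_gt0_exists (R : realType) (P : R -> Prop) :
  {ae (@lebesgue_measure R), forall t : R, 0 < t -> P t} -> exists t, P t.
Proof.
move=> [B [mB B0 PB]]; apply: contrapT => nP.
have : (lebesgue_measure `]0%R, 1%R[%classic <= @lebesgue_measure R B)%E.
  apply: le_measure; rewrite ?inE//.
  move=> t /=; rewrite in_itv/= => /andP[t0 _]; apply: PB => /= Pt.
  by apply: nP; exists t; exact: Pt.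
by rewrite B0 lebesgue_measure_itv/= lte_fin ltr01 oppr0 adde0 lee_fin ler10.
Qed.

Lemma limf_esup_exp_bound (R : realType) (c A k : R) (g : R -> R) : 0 < c ->
  (forall t : R, 0 <= t -> g t <= expR (- c * t) * A + k) ->
  (limf_esup (fun t => (g t)%:E) (pinfty_nbhs R) <= k%:E)%E.
Proof.
move=> c0 gA; apply/lee_addgt0Pr => e e0; rewrite limf_esupE; apply: ge_ereal_inf.
(* Beyond [M], exp(ct) >= 1 + ct > |A| / e, so the transient is below [e]. *)
pose M := `|A| / (c * e).
have M0 : 0 <= M by rewrite divr_ge0// mulr_ge0// ltW.
exists (ereal_sup ((fun t => (g t)%:E) @` [set t | M < t])).
  by exists [set t | M < t] => //; exists M; split=> //; exact: num_real.
apply: ge_ereal_sup => _ [t /= Mt <-]; rewrite -EFinD lee_fin.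
have t0 : 0 < t by exact: le_lt_trans Mt.
apply: (le_trans (gA t (ltW t0))); rewrite addrC lerD2l mulNr expRN mulrC.
rewrite ler_pdivrMr ?expR_gt0// (le_trans (ler_norm A))//.
move: Mt; rewrite /M ltr_pdivrMr ?mulr_gt0// => /ltW/le_trans; apply.
rewrite (_ : t * (c * e) = e * (c * t)); last by ring.
by rewrite ler_pM2l//; have := expR_ge1Dx (c * t); lra.
Qed.

(** * Tracking of the quasi-steady state *)

Theorem mainTheorem6 (R : realType) (N : nat) (hN : (2 <= N)%N)
    (Rth : 'M[R]_(N.-1, N))
    (hRth_orthonormal : Rth *m Rth^T = 1%:M)
    (hRth_span : forall v : 'rV[R]_N,
       (v <= Rth)%MS <-> v *m (const_mx 1 : 'cV[R]_N) = 0)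
    (U D : set 'cV[R]_(N + N))
    (f : 'cV[R]_(N + N) -> 'cV[R]_(N + N) -> 'cV[R]_(N + N))
    (ubar utilde u x : R -> 'cV[R]_(N + N))
    (xs : 'cV[R]_(N + N) -> 'cV[R]_(N + N))
    (Dxs : 'cV[R]_(N + N) -> 'M[R]_(N + N, N + N))
    (c H Lu eps delta rho0 : R)
    (* system *)
    (hf : forall w, U w -> C1 (f^~ w))
    (hc : 0 < c)
    (hD : convex_set D)
    (hcontr : semi_contracting (Rmat Rth) D f u c)
    (hker : kernel_invariant (Rmat Rth) D f u)
    (* inputs *)
    (hu : forall t : R, 0 <= t -> u t = ubar t + utilde t)
    (huU : forall t : R, 0 <= t -> U (u t))
    (hubarU : forall t : R, 0 <= t -> U (ubar t))
    (hubar_ac : forall T : R, 0 < T -> abs_continuous 0 T ubar)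
    (hubar : {ae lebesgue_measure, forall t : R, 0 < t ->
       derivable ubar t 1 /\ norm2 ('D_1 ubar t) <= eps})
    (hutilde : forall t : R, 0 <= t -> norm2 (utilde t) <= delta)
    (* quasi-steady map *)
    (hxsD : forall w, U w -> D (xs w))
    (hxsC1 : C1_on U xs Dxs)
    (hxs0 : forall w, U w -> snorm (Rmat Rth) (f (xs w) w) = 0)
    (hH : forall w, U w -> inputnormR (Rmat Rth) (Dxs w) <= H)
    (hLu0 : 0 <= Lu)
    (hLu : forall (t : R) w, 0 <= t -> U w ->
       snorm (Rmat Rth) (f (xs (ubar t)) w - f (xs (ubar t)) (ubar t))
         <= Lu * norm2 (w - ubar t))
    (* solution *)
    (hx : is_solution f u x)
    (hxD : forall t : R, 0 <= t -> D (x t))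
    (hrho0 : distR (Rmat Rth) (x 0) (xs (ubar 0)) <= rho0) :
  (forall t : R, 0 <= t ->
     distR (Rmat Rth) (x t) (xs (ubar t)) <=
       expR (- c * t) * rho0 + (H * eps + Lu * delta) / c * (1 - expR (- c * t)))
  /\
  (limf_esup (fun t : R => (distR (Rmat Rth) (x t) (xs (ubar t)))%:E)
     (pinfty_nbhs R) <= ((H * eps + Lu * delta) / c)%:E)%E.
Proof.
set Q := Rmat Rth.
have QQt : Q *m Q^T = 1%:M by exact: Rmat_orthonormal.
have N0 : (0 < N)%N by exact: leq_trans hN.
have N20 : (0 < N + N)%N by rewrite addn_gt0 N0.
have m0 : (0 < N.-1 + N)%N by rewrite addn_gt0 N0 orbT.
have H0 : 0 <= H.
  by apply: le_trans (hH _ (hubarU _ (lexx 0))); exact: inputnormR_ge0.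
have eps0 : 0 <= eps.
  by have [t [_]] := ae_gt0_exists hubar; exact/le_trans/norm2_ge0.
have delta0 : 0 <= delta by apply: le_trans (hutilde 0 (lexx 0)); exact: norm2_ge0.
set K := H * eps + Lu * delta.
have K0 : 0 <= K by rewrite addr_ge0// mulr_ge0.
pose e t := Q *m (x t - xs (ubar t)).
have distE t : distR Q (x t) (xs (ubar t)) = norm2 (e t) by rewrite distRE.
have [xac xder] := hx.
(* The derivative of the error splits into contraction between [x] and [y] under the same input
   ([h1]), input mismatch at [y] ([h2]), the field at [y] under [ubar], annihilated by [Q] ([h3]),
   and drift of the reference ([h4]). *)
have e_form t v : 0 <= t -> norm2 v <= eps ->
    dot (e t) (Q *m (f (x t) (u t) - Dxs (ubar t) *m v))
      <= - c * norm2 (e t) ^+ 2 + K * norm2 (e t).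
  move=> t0 veps; have Ut := hubarU t t0; set y := xs (ubar t).
  have Dy : D y by exact: hxsD.
  have h1 : dot (e t) (Q *m (f (x t) (u t) - f y (u t))) <= - c * norm2 (e t) ^+ 2.
    have formF p z : D p -> dot (Q *m z) (Q *m (jacmx (f^~ (u t)) p *m z))
        <= - c * snorm Q z ^+ 2.
      move=> Dp; apply: lognormR_form_le => //; last exact: hcontr.
      by move=> k; exact: hker.
    exact: (form_le_of_jacmx hD (hf _ (huU t t0)).1 formF (hxD t t0) Dy).
  have h2 : dot (e t) (Q *m (f y (u t) - f y (ubar t))) <= norm2 (e t) * (Lu * delta).
    rewrite (le_trans (dot_le _ _))// ler_wpM2l ?norm2_ge0//.
    rewrite (le_trans (hLu t _ t0 (huU t t0)))// ler_wpM2l//.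
    by rewrite hu// addrAC subrr add0r hutilde.
  have h3 : Q *m f y (ubar t) = 0 by apply: norm2_eq0; exact: hxs0.
  have h4 : dot (e t) (- (Q *m (Dxs (ubar t) *m v))) <= norm2 (e t) * (H * eps).
    rewrite (le_trans (dot_le _ _))// ler_wpM2l ?norm2_ge0// norm2N.
    rewrite (le_trans (inputnormR_ge Q _ _))//.
    by apply: ler_pM; rewrite ?norm2_ge0 ?inputnormR_ge0// hH.
  have -> : Q *m (f (x t) (u t) - Dxs (ubar t) *m v) =
      Q *m (f (x t) (u t) - f y (u t)) + Q *m (f y (u t) - f y (ubar t))
      - Q *m (Dxs (ubar t) *m v).
    by rewrite -mulmxDr addrA subrK !mulmxBr h3 subr0.
  rewrite !dotDr; apply: le_trans (lerD (lerD h1 h2) h4) _.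
  by rewrite -addrA -mulrDr [_ + H * eps]addrC [X in _ + X]mulrC.
have [CQ CQ0 hCQ] := mulmx_bounded Q.
pose n : R := (N + N)%:R.
have n0 : 0 <= n by rewrite ler0n.
have hQ v : norm2 (Q *m v) <= CQ * n * `|v|.
  by rewrite (le_trans (hCQ v))// -mulrA ler_wpM2l// norm2_le_norm.
pose w l r := `|x r - x l| + `|ubar r - ubar l|.
pose C := CQ * n + H * n.
have C0 : 0 <= C by rewrite addr_ge0// mulr_ge0.
have w_small T : 0 < T -> small_sums 0 T w.
  by move=> T0; apply: small_sumsD; [exact: xac|exact: hubar_ac].
(* Differentiability of [xs] at [ubar t], taken with error 1, suffices. The linear part is bounded
   through [H], so the constant [C] is the same at every time. *)
have e_dom T : 0 < T -> dominated_on 0 T w C (fun s t => norm2 (e s - e t)).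
  move=> T0 t tT; have /andP[t0 _] := tT; have Ut := hubarU t t0.
  have := hxsC1.1 _ Ut _ ltr01; rewrite near_withinE => /nbhs_normP[r /= r0 near_xs].
  have ubar_small : small_sums 0 T (fun l r => `|ubar r - ubar l|) by exact: hubar_ac.
  have := small_sums_near ubar_small r0 tT; apply: filterS => s near_ubar sT.
  have /andP[s0 _] := sT.
  have wE : w (Num.min s t) (Num.max s t) = `|x s - x t| + `|ubar s - ubar t|.
    by rewrite /w; case: (leP s t) => _ //; rewrite distrC [`|ubar _ - _|]distrC.
  have ubar_r : `|ubar t - ubar s| < r.
    by have := near_ubar sT; rewrite /=; case: (leP s t) => _ //; rewrite distrC.
  have xs_le := near_xs (ubar s) ubar_r (hubarU s s0); rewrite mul1r in xs_le.
  set k := xs (ubar s) - xs (ubar t) - Dxs (ubar t) *m (ubar s - ubar t) in xs_le.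
  have -> : e s - e t = Q *m (x s - x t)
      - (Q *m k + Q *m (Dxs (ubar t) *m (ubar s - ubar t))).
    rewrite -mulmxDr subrK /e -!mulmxBr; congr (Q *m _).
    rewrite !opprD !opprK !addrA; congr (_ + _).
    by rewrite -!addrA; congr (_ + _); rewrite addrC.
  have h1 := hQ (x s - x t).
  have h2 : norm2 (Q *m k) <= CQ * n * `|ubar s - ubar t|.
    by rewrite (le_trans (hQ k))// ler_wpM2l// mulr_ge0.
  have h3 : norm2 (Q *m (Dxs (ubar t) *m (ubar s - ubar t))) <= H * n * `|ubar s - ubar t|.
    rewrite (le_trans (inputnormR_ge Q _ _))// -mulrA.
    by apply: ler_pM; rewrite ?norm2_ge0 ?inputnormR_ge0 ?norm2_le_norm// hH.
  rewrite wE (le_trans (norm2D _ _))// norm2N.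
  apply: le_trans (lerD h1 (le_trans (norm2D _ _) (lerD h2 h3))) _.
  have := mulr_ge0 (mulr_ge0 H0 n0) (normr_ge0 (x s - x t)).
  by rewrite /C; clear; lra.
have bound t : 0 <= t -> norm2 (e t) <=
    expR (- c * t) * norm2 (e 0) + K / c * (1 - expR (- c * t)).
  (* Time 0 is separate, as absolute continuity is given on intervals of positive length. *)
  rewrite le_eqVlt => /predU1P[<-|T0].
    by rewrite mulr0 expR0 mul1r subrr mulr0 addr0.
  have w0 l r : 0 <= w l r by rewrite addr_ge0.
  apply: (norm2_gronwall_ae (ltW T0) hc K0 C0 w0 (w_small t T0)
    (negligibleU hubar xder) (e_dom t T0)) => s /andP[s0 _].
  move=> /not_orP[/contrapT/(_ s0)[ubd ubeps] /contrapT/(_ s0) xd].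
  exists (Q *m (f (x s) (u s) - Dxs (ubar s) *m 'D_1 ubar s)); last first.
    by apply: e_form => //; exact: ltW.
  have yd : is_derive s (1 : R) (xs \o ubar) (Dxs (ubar s) *m 'D_1 ubar s).
    apply: (C1_on_derive hxsC1); last exact: derivableP.
    (* Positivity of [s] keeps a two-sided neighbourhood within the times at which [ubar] lies in
       [U]. *)
    by near=> r; apply: hubarU; apply: ltW; near: r; exact: lt_nbhsr.
  exact: (is_derive_mulmx Q (is_deriveB xd yd)).
have bound_rho t : 0 <= t -> distR Q (x t) (xs (ubar t)) <=
    expR (- c * t) * rho0 + K / c * (1 - expR (- c * t)).
  move=> t0; rewrite distE (le_trans (bound t t0))// lerD2r ler_wpM2l ?expR_ge0//.
  by rewrite -distE.
(* Collecting the exponential terms leaves [rho0 - K / c] as their coefficient and [K / c] as the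
   limit. *)
split=> //; apply: (limf_esup_exp_bound (A := rho0 - K / c) hc) => t t0.
rewrite (le_trans (bound_rho t t0))// le_eqVlt; apply/orP; left; apply/eqP; ring.
Unshelve. all: by end_near. Qed.
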